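(* Let $W$ be a finite word over a finite alphabet. Then the following two conditions are equivalent: (A) $W$ is a rich palindrome; (B) $P_W(n)+P_W(n+1)=C_W(n+1)-C_W(n)+2$ for each integer $0\leq n\leq |W|$.
   Context: For a finite word $W$, $|W|$ denotes its length. A factor of $W$ is a (possibly empty) contiguous block of letters of $W$. A palindrome is a word equal to its reversal (the empty word is a palindrome). $C_W(n)$ denotes the number of distinct factors of $W$ of length $n$, and $P_W(n)$ the number of distinct palindromic factors of $W$ of length $n$, for every integer $n\geq 0$ (so $C_W(0)=P_W(0)=1$ and $C_W(n)=P_W(n)=0$ for $n>|W|$). A finite word $W$ is called rich if it has exactly $|W|+1$ distinct palindromic factors, counting the empty word (this is the maximum possible number). *)

(* Defs.v *)
From mathcomp Require Import all_boot.

Set Implicit Arguments.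
Unset Strict Implicit.
Unset Printing Implicit Defensive.

Section Words.

Variable T : eqType.
Implicit Types u w : seq T.

(* Duplicate-free, so that sizes and counts below count distinct factors;
   the members are exactly the [u] with [infix u w], cf. [mem_factors]. *)
Definition factors w : seq (seq T) :=
  undup [seq take l (drop i w) | i <- iota 0 (size w).+1,
                                 l <- iota 0 (size w).+1].

Definition palindrome u : bool := rev u == u.

Definition factor_complexity w (n : nat) : nat :=
  count (fun u => size u == n) (factors w).

Definition palindromic_complexity w (n : nat) : nat :=
  count (fun u => palindrome u && (size u == n)) (factors w).

Definition rich w : bool := count palindrome (factors w) == (size w).+1.

Lemma factors_uniq w : uniq (factors w).
Proof. exact: undup_uniq. Qed.

Lemma mem_factors u w : (u \in factors w) = infix u w.
Proof.
rewrite mem_undup; apply/allpairsP/infixP => [[[i l] /= [_ _ ->]]|[p [s ->]]].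
  exists (take i w), (drop l (drop i w)).
  by rewrite !cat_take_drop.
exists (size p, size u); rewrite !mem_iota !leq0n !add0n !ltnS !size_cat /=.
split; first exact: leq_addr.
  by rewrite addnCA leq_addr.
by rewrite drop_size_cat // take_size_cat.
Qed.

End Words.

(* Main.v *)
Require Import Defs.
From mathcomp Require Import all_boot all_order all_algebra.
From mathcomp Require Import zify.

Set Implicit Arguments.
Unset Strict Implicit.
Unset Printing Implicit Defensive.

(** Summing (B) over all [n] telescopes to [2 * #palindromes - 1 = 2 * |W| + 1],
    i.e. to richness, and its instance [n = |W|] says that [W] is a palindrome.
    For the converse it then suffices that every palindrome satisfies (B) with
    [<=] instead of [=].  Consider the graph whose vertices are the factors of
    length [n] up to reversal and whose edges are the factors of length [n + 1]
    up to reversal: reading [W] is a walk through all the vertices, so the graph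
    is connected, and palindromic edges are loops.  Hence
    [(C n + P n) / 2 - 1 <= (C (n + 1) - P (n + 1)) / 2]. *)

Section Complexity.

Variable T : eqType.
Implicit Types (u w : seq T) (a : T) (n : nat).

(** The set is closed under reversal instead of quotiented by it: a class [{u, rev u}] shows up as
    two words, or as one palindrome. Twice the number of classes is thus the count of all members
    plus the count of palindromes, and twice the number of non-palindromic classes is the count of
    non-palindromes. *)
Definition rev_factors n w : seq (seq T) :=
  undup [seq u <- factors w ++ [seq rev v | v <- factors w] | size u == n].

Lemma rev_factors_uniq n w : uniq (rev_factors n w).
Proof. exact: undup_uniq. Qed.

Lemma mem_rev_factors n w u :
  (u \in rev_factors n w) = (size u == n) && (infix u w || infix (rev u) w).
Proof.
rewrite mem_undup mem_filter mem_cat mem_factors; congr (_ && (_ || _)).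
by rewrite -[u in LHS]revK (mem_map (can_inj revK)) mem_factors.
Qed.

Lemma infix_eq_size u w : size u = size w -> infix u w = (u == w).
Proof.
move=> szu; apply/idP/eqP => [/infixP[p [s def_w]]|->]; last exact: infix_refl.
move: szu; rewrite def_w !size_cat.
by case: p s {def_w} => [|? ?] [|? ?] /=; rewrite ?cats0 //; lia.
Qed.

Lemma infix_cons n a w u : size u = n ->
  infix u (a :: w) = (u == take n (a :: w)) || infix u w.
Proof.
by move=> <-; rewrite infix_consl prefixE eq_sym.
Qed.

Lemma mem_rev_factors_cons n a w u : n <= (size w).+1 ->
  (u \in rev_factors n (a :: w)) =
  (u \in [:: take n (a :: w); rev (take n (a :: w))]) || (u \in rev_factors n w).
Proof.
move=> le_nw; rewrite !mem_rev_factors !inE.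
have szx : size (take n (a :: w)) = n by rewrite size_takel.
have [szu|szu] := eqVneq (size u) n; last first.
  rewrite orbF; apply/esym/norP; split; apply: contra_neq szu => -> //.
  by rewrite size_rev.
rewrite !(@infix_cons n) ?size_rev //= (can2_eq revK revK).
by rewrite -!orbA; congr (_ || _); rewrite orbCA.
Qed.

(** The weight of one vertex: a palindrome is a single word counted twice, any other class consists
    of two words counted once each. *)
Lemma undup_rev_weight u :
  count predT (undup [:: u; rev u]) + count (@palindrome T) (undup [:: u; rev u])
  = 2.
Proof.
have [e|ne] := eqVneq u (rev u); rewrite /palindrome /= inE.
  by rewrite -e eqxx /= -e eqxx.
by rewrite (negPf ne) /= revK (eq_sym (rev u)) (negPf ne).
Qed.

(* Induction on [w]: when the prefix [x] of length [n] of [a :: w] is new up to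
   reversal, the left-hand side grows by 2, whether [x] is a palindrome (counted
   twice) or not, and so does the right-hand side: the prefix [y] of length
   [n + 1] is then new up to reversal too, and is not a palindrome because
   otherwise [rev x] would be a prefix of [w]. *)
Lemma rev_factors_le n w : n <= size w ->
  count predT (rev_factors n w) + count (@palindrome T) (rev_factors n w)
  <= count (predC (@palindrome T)) (rev_factors n.+1 w) + 2.
Proof.
(* A word of length exactly [n] gives a single vertex, so the constant 2 on the right suffices
   whatever the edges are. *)
have base v : size v = n ->
  count predT (rev_factors n v) + count (@palindrome T) (rev_factors n v) = 2.
  move=> szv; rewrite -(undup_rev_weight v).
  have /permP eq_cnt : perm_eq (rev_factors n v) (undup [:: v; rev v]).
    apply: uniq_perm; rewrite ?undup_uniq // => u.
    rewrite mem_rev_factors mem_undup !inE.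
    have [szu|szu] := eqVneq (size u) n.
      by rewrite !infix_eq_size ?size_rev ?szu // (can2_eq revK revK).
    apply/esym/norP; split; apply: contra_neq szu => -> //.
    by rewrite size_rev.
  by rewrite !eq_cnt.
elim: w => [|a w IHw] /= le_nw.
  by rewrite base ?leq_addl //; case: n le_nw {base}.
have [lt_wn|le_nw'] := ltnP (size w) n.
  by rewrite base ?leq_addl //=; apply/eqP; rewrite eqn_leq lt_wn.
have {IHw} := IHw le_nw'.
set x := take n (a :: w); set y := take n.+1 (a :: w).
have szx : size x = n by rewrite size_takel.
have szy : size y = n.+1 by rewrite size_takel.
have memV u := @mem_rev_factors_cons n a w u le_nw.
have memE u := @mem_rev_factors_cons n.+1 a w u le_nw'.
have mem_x z : (rev z \in rev_factors n w) = (z \in rev_factors n w).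
  by rewrite !mem_rev_factors revK size_rev orbC.
have mem_y z : (rev z \in rev_factors n.+1 w) = (z \in rev_factors n.+1 w).
  by rewrite !mem_rev_factors revK size_rev orbC.
(* If [x] is an old vertex, the left-hand side does not change and the edges of [w] all remain. *)
have [xV|xnV] := boolP (x \in rev_factors n w).
  have /permP eq_cnt : perm_eq (rev_factors n (a :: w)) (rev_factors n w).
    apply: uniq_perm; rewrite ?rev_factors_uniq // => u.
    rewrite memV !inE -/x; case: eqVneq => [->|_] //=.
    by case: eqVneq => [->|_] //=; rewrite mem_x.
  rewrite !eq_cnt => /leq_trans-> //; rewrite leq_add2r -!size_filter.
  apply: uniq_leq_size => [|u]; first by rewrite filter_uniq ?rev_factors_uniq.
  by rewrite !mem_filter memE => /andP[-> ->]; rewrite orbT.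
have eq_cnt p : count p (rev_factors n (a :: w)) =
    count p (undup [:: x; rev x] ++ rev_factors n w).
  apply/permP/uniq_perm: p; first exact: rev_factors_uniq.
    rewrite cat_uniq undup_uniq rev_factors_uniq andbT; apply/hasPn => u uV.
    rewrite mem_undup !inE; apply/norP.
    by split; apply: contraNneq xnV => def_u; rewrite -?def_u // -mem_x -def_u.
  by move=> u; rewrite memV mem_cat mem_undup.
have def_x : x = take n y by rewrite /y take_takel.
have ynpal : ~~ palindrome y.
  apply: contra xnV => /eqP pal_y; rewrite -mem_x mem_rev_factors size_rev.
  rewrite szx eqxx /=; apply/orP; left.
  suff -> : rev x = take n w by apply: infix_take.
  by rewrite def_x rev_take szy pal_y subSnn /y /= drop0.
(* An occurrence of [y] or [rev y] in [w] contains one of [x] or [rev x], so an old edge would make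
   [x] an old vertex. *)
have ynE : y \notin rev_factors n.+1 w.
  apply: contra xnV; rewrite !mem_rev_factors szx szy !eqxx /=.
  have xy : infix x y by rewrite def_x infix_take.
  case/orP=> yw; apply/orP; [left | right]; apply: infix_trans yw => //.
  by rewrite infix_rev.
rewrite !eq_cnt !count_cat addnACA undup_rev_weight => IHw.
rewrite addnC leq_add2r; apply: leq_trans IHw _; rewrite addnC.
(* The growth by 2 is realised by the distinct words [y] and [rev y]. *)
rewrite -!size_filter -[2]/(size [:: y; rev y]) -size_cat.
apply: uniq_leq_size => [|u].
  rewrite cat_uniq filter_uniq ?rev_factors_uniq //= inE eq_sym.
  rewrite [_ == _](negPf ynpal) /= andbT; apply/hasPn => u.
  rewrite mem_filter => /andP[_ uE]; rewrite !inE.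
  apply/norP; split; apply: contraNneq ynE => def_u.
    by rewrite -def_u.
  by rewrite -mem_y -def_u.
rewrite mem_cat !mem_filter memE => /orP[uy|/andP[-> ->]]; last by rewrite orbT.
rewrite uy andbT /=; move: uy; rewrite !inE => /orP[]/eqP-> //.
by rewrite /palindrome revK eq_sym.
Qed.

(** The factors of a palindrome are already closed under reversal, so adjoining the reversals adds
    nothing. *)
Lemma count_rev_factors (p : pred (seq T)) n w : palindrome w ->
  count p (rev_factors n w) = count (fun u => p u && (size u == n)) (factors w).
Proof.
move=> /eqP pal_w.
have /permP-> : perm_eq (rev_factors n w) [seq u <- factors w | size u == n].
  apply: uniq_perm; rewrite ?filter_uniq ?factors_uniq ?rev_factors_uniq // => u.
  by rewrite mem_rev_factors mem_filter mem_factors -{2}pal_w infix_rev orbb.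
by rewrite count_filter.
Qed.

(** This is [rev_factors_le] with the palindromes of length [n.+1] added to both sides, which avoids
    truncated subtraction. *)
Lemma palindrome_complexity_le n w : palindrome w -> n <= size w ->
  factor_complexity w n + palindromic_complexity w n
    + palindromic_complexity w n.+1
  <= factor_complexity w n.+1 + 2.
Proof.
move=> pal_w /rev_factors_le; rewrite !count_rev_factors // => le_w.
have <- : palindromic_complexity w n.+1
    + count (fun u => ~~ palindrome u && (size u == n.+1)) (factors w)
    = factor_complexity w n.+1.
  rewrite /palindromic_complexity /factor_complexity -[RHS]size_filter.
  by rewrite -(count_predC (@palindrome T)) !count_filter.
by rewrite addnC -addnA leq_add2l.
Qed.

Lemma sum_count_size (s : seq (seq T)) (p : pred (seq T)) N :
  all (fun u => size u < N) s ->
  \sum_(n < N) count (fun u => p u && (size u == n)) s = count p s.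
Proof.
elim: s => [|u s IHs] /= => [_|/andP[ltuN /IHs <-]]; first by rewrite big1.
rewrite big_split /=; congr (_ + _).
rewrite (bigD1 (Ordinal ltuN)) //= eqxx andbT big1 ?addn0 // => i ne_i.
by rewrite [size u == i]eq_sym (negPf ne_i : (i == size u :> nat) = false) andbF.
Qed.

Lemma sum_palindromic_complexity w :
  \sum_(n < (size w).+1) palindromic_complexity w n
  = count (@palindrome T) (factors w).
Proof.
apply: sum_count_size; apply/allP => u; rewrite mem_factors ltnS.
exact: size_infix.
Qed.

Lemma factor_complexity0 w : factor_complexity w 0 = 1.
Proof.
rewrite /factor_complexity (eq_count (a2 := pred1 [::])) => [|[]] //.
by rewrite count_uniq_mem ?factors_uniq // mem_factors infix0s.
Qed.

Lemma palindromic_complexity0 w : palindromic_complexity w 0 = 1.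
Proof.
rewrite -[RHS](factor_complexity0 w); apply: eq_count => -[|x u] //=.
by rewrite andbF.
Qed.

Lemma factor_complexity_size w : factor_complexity w (size w) = 1.
Proof.
rewrite /factor_complexity (eq_in_count (a2 := pred1 w)).
  by rewrite count_uniq_mem ?factors_uniq // mem_factors infix_refl.
move=> u; rewrite mem_factors /= => uw; have [szu|] := eqVneq (size u).
  by rewrite -(infix_eq_size szu) uw.
by move=> ne_uw; apply/esym; apply: contra_neqF ne_uw => /eqP->.
Qed.

Lemma factor_complexity_gt w n : size w < n -> factor_complexity w n = 0.
Proof.
move=> lt_wn; apply/eqP; rewrite -leqn0 leqNgt -has_count.
apply/hasP => -[u]; rewrite mem_factors => /size_infix le_uw /eqP; lia.
Qed.

Lemma palindromic_complexity_le w n :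
  palindromic_complexity w n <= factor_complexity w n.
Proof. by apply: sub_count => u /andP[]. Qed.

Lemma palindromic_complexity_size w :
  0 < palindromic_complexity w (size w) -> palindrome w.
Proof.
rewrite -has_count => /hasP[u]; rewrite mem_factors => uw /andP[pal_u /eqP szu].
by move: uw; rewrite infix_eq_size // => /eqP <-.
Qed.

End Complexity.

Import GRing.Theory Num.Theory.

(** Right-hand side of (B) minus left-hand side, in [int] because the factor complexity can decrease
    with [n]. *)
Definition complexity_defect (T : eqType) (w : seq T) (n : nat) : int :=
  ((factor_complexity w n.+1)%:Z - (factor_complexity w n)%:Z + 2
   - ((palindromic_complexity w n)%:Z + (palindromic_complexity w n.+1)%:Z))%R.

Lemma complexity_defect_ge0 (T : eqType) (w : seq T) n :
  palindrome w -> n <= size w -> (0 <= complexity_defect w n)%R.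
Proof.
by move=> pal_w /(palindrome_complexity_le pal_w); rewrite /complexity_defect; lia.
Qed.

Lemma sum_complexity_defect (T : eqType) (w : seq T) :
  (\sum_(n < (size w).+1) complexity_defect w n
   = ((size w).+1%:Z - (count (@palindrome T) (factors w))%:Z) *+ 2)%R.
Proof.
have sumP : (\sum_(n < (size w).+1) (palindromic_complexity w n)%:Z
  = (count (@palindrome T) (factors w))%:Z)%R.
  by rewrite -sum_palindromic_complexity -!natz natr_sum;
    apply: eq_bigr => i _; rewrite natz.
(* The shift loses P(0) = 1 and gains P(|w| + 1) = 0; this deficit of 1 is cancelled by the
   telescoped C(|w| + 1) - C(0) = -1. *)
have sumP1 : (\sum_(n < (size w).+1) (palindromic_complexity w n.+1)%:Z
  = (count (@palindrome T) (factors w))%:Z - 1)%R.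
  rewrite -sumP big_ord_recr [in RHS]big_ord_recl /= palindromic_complexity0.
  have := palindromic_complexity_le w (size w).+1.
  by rewrite factor_complexity_gt // leqn0 => /eqP->; rewrite addr0 addrC addKr.
rewrite sumrB big_split [X in (_ - X)%R]big_split /= sumP sumP1 sumr_const card_ord.
rewrite -(big_mkord predT (fun n => ((factor_complexity w n.+1)%:Z
  - (factor_complexity w n)%:Z)%R)) telescope_sumr //.
rewrite factor_complexity_gt // factor_complexity0; lia.
Qed.

Lemma rich_palindromeP (T : eqType) (w : seq T) :
  rich w /\ palindrome w <->
  (forall n, n <= size w -> complexity_defect w n = 0%R).
Proof.
have sum_defect := sum_complexity_defect w.
split=> [[/eqP rich_w pal_w] n le_nw | defect0].
  rewrite rich_w subrr mul0rn in sum_defect.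
  (* Nonnegative defects with sum zero all vanish. *)
  apply: (psumr_eq0P _ sum_defect (i := Ordinal (le_nw : n < (size w).+1))) => //.
  by move=> i _; apply: complexity_defect_ge0; rewrite // -ltnS.
split.
  move: sum_defect; rewrite big1 => [|i _]; last by rewrite defect0 // -ltnS.
  by move=> ?; apply/eqP; lia.
(* At [n = size w] the equation reads P(|w|) + 0 = 0 - 1 + 2, so some palindromic factor has full
   length. *)
apply: palindromic_complexity_size; have := defect0 _ (leqnn _).
rewrite /complexity_defect factor_complexity_size factor_complexity_gt //.
have := palindromic_complexity_le w (size w).+1.
by rewrite factor_complexity_gt //; lia.
Qed.

Theorem theorem1 (A : finType) (W : seq A) :
  rich W /\ palindrome W <->
  (forall n : nat, n <= size W ->
     ((palindromic_complexity W n)%:Z + (palindromic_complexity W n.+1)%:Z =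
      (factor_complexity W n.+1)%:Z - (factor_complexity W n)%:Z + 2 :> int)%R).
Proof.
split=> [/rich_palindromeP defect0 n /defect0/subr0_eq // | eqW].
by apply/rich_palindromeP => n /eqW; rewrite /complexity_defect => ->; rewrite subrr.
Qed.
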